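(* Let $G$ be an infinite, finitely generated group and let $T$ be an equicontinuous (continuous) action of $G$ on the Cantor space $X$. Then $T$ has the pseudo-orbit tracing property (POTP).
   Context: The Cantor space is the (unique up to homeomorphism) nonempty compact, totally disconnected, metrizable space without isolated points; $d$ denotes a compatible metric on it. A continuous action $T$ of $G$ on $X$ is equicontinuous if for every $\varepsilon>0$ there is $\delta>0$ such that $d(x,y)<\delta$ implies $d(T_gx,T_gy)<\varepsilon$ for every $g\in G$. POTP: Let $A$ be a finite generating set of $G$. For $\delta>0$, a $\delta$ pseudo-orbit of $T$ with respect to $A$ is a family $\{x_g\}_{g\in G}$ in $X$ with $d(T_ax_g,x_{ag})<\delta$ for all $a\in A$, $g\in G$. $T$ has POTP (with respect to $A$) if for every $\varepsilon>0$ there is $\delta>0$ such that for every $\delta$ pseudo-orbit $\{x_g\}_{g\in G}$ of $T$ with respect to $A$ there is $x\in X$ with $d(T_gx,x_g)<\varepsilon$ for all $g\in G$. This property does not depend on the choice of compatible metric $d$ or of finite generating set $A$, and one says $T$ has POTP if it holds for some such choice. *)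

(* Defs.v *)
From HB Require Import structures.
From mathcomp Require Import all_boot all_order all_algebra all_fingroup.
From mathcomp Require Import all_classical all_reals all_analysis.

Set Implicit Arguments.
Unset Strict Implicit.
Unset Printing Implicit Defensive.

Local Open Scope classical_set_scope.
Local Open Scope ring_scope.

(* [X] is the Cantor space; metrizability is carried by [metricType]. The
   library's [cantor_like] asks for [zero_dimensional] instead of
   [totally_disconnected] and does not ask for a point. *)
Definition is_cantor_space (R : realType) (X : metricType R) : Prop :=
  [/\ [set: X] !=set0,
      compact [set: X],
      totally_disconnected [set: X] &
      isolated [set: X] = set0].

Definition generates (G : groupType) (A : set G) : Prop :=
  forall H : {pred G}, group_closed H -> A `<=` [set` H] ->
    [set` H] = [set: G].

Definition finitely_generated (G : groupType) : Prop :=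
  exists A : set G, finite_set A /\ generates A.

(* Left action: [T (g * h)] is [T h] followed by [T g], and [G] is discrete.
   The [action]s of fingroup are right actions of finite groups. *)
Definition continuous_action (G : groupType) (X : topologicalType)
    (T : G -> X -> X) : Prop :=
  [/\ forall x, T 1%g x = x,
      forall g h x, T (g * h)%g x = T g (T h x) &
      forall g, continuous (T g)].

(* Uniform in the base point, unlike the library's [equicontinuous]. *)
Definition equicontinuous_action (R : realType) (G : groupType)
    (X : metricType R) (T : G -> X -> X) : Prop :=
  forall eps : R, 0 < eps -> exists2 delta : R, 0 < delta &
    forall x y : X, mdist x y < delta -> forall g, mdist (T g x) (T g y) < eps.

Definition pseudo_orbit (R : realType) (G : groupType) (X : metricType R)
    (T : G -> X -> X) (A : set G) (delta : R) (x : G -> X) : Prop :=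
  forall a g, A a -> mdist (T a (x g)) (x (a * g)%g) < delta.

Definition POTP_wrt (R : realType) (G : groupType) (X : metricType R)
    (T : G -> X -> X) (A : set G) : Prop :=
  forall eps : R, 0 < eps -> exists2 delta : R, 0 < delta &
    forall x : G -> X, pseudo_orbit T A delta x ->
      exists y : X, forall g, mdist (T g y) (x g) < eps.

Definition POTP (R : realType) (G : groupType) (X : metricType R)
    (T : G -> X -> X) : Prop :=
  exists A : set G, [/\ finite_set A, generates A & POTP_wrt T A].

(* Main.v *)
Require Import Defs.
From mathcomp Require Import all_boot all_order all_algebra all_fingroup.
From mathcomp Require Import all_classical all_reals all_analysis.
From mathcomp Require Import lra.

(** Call two points [e]-chained when finitely many jumps of length less than
    [e] lead from one to the other. In a compact totally disconnected metric
    space, points that are [e]-chained for every [e] are equal, and by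
    compactness this is uniform: for each [eps] there is an [eta] such that
    [eta]-chained points are less than [eps] apart ([chained_mdist_small]).

    Given [eps], take such an [eta] and let [E u v] say that [T h u] and
    [T h v] are [eta]-chained for every [h]. This is an equivalence relation
    preserved by the action. It is finer than [eps]-closeness (take [h = 1]),
    and equicontinuity provides a [delta] such that [delta]-close points are
    [E]-related. A [delta] pseudo-orbit is therefore an exact orbit modulo
    [E], at first along the generators only; since [E] is a congruence this
    extends to the whole group ([pseudo_orbit_invariant_rel]). No error
    accumulates along words in the generators, so the orbit of [x 1] traces
    the pseudo-orbit [x].

    The uniform statement follows from the fact that the set of points chained
    to [x] at every scale is connected ([connected_quasi_component]): if it
    split into two closed pieces, these would be at positive distance, and at
    a small scale the chains from [x] would be confined to neighbourhoods of
    the two pieces without being able to jump from one to the other. *)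

Set Implicit Arguments.
Unset Strict Implicit.
Unset Printing Implicit Defensive.

Import Order.TTheory GRing.Theory Num.Theory.

Local Open Scope classical_set_scope.
Local Open Scope ring_scope.

Section Chains.
Variables (R : realType) (X : metricType R).
Implicit Types (x y z : X) (e : R) (A B K : set X).

Definition step_closed e A := forall u v, A u -> mdist u v < e -> A v.

(** Chains are encoded as membership in every set stable under jumps of length
    less than [e], so that no sequence of points has to be handled. *)
Definition chained e x y := forall A, A x -> step_closed e A -> A y.

Lemma chained_refl e x : chained e x x. Proof. by move=> A. Qed.

Lemma chained_trans e y x z : chained e x y -> chained e y z -> chained e x z.
Proof. by move=> xy yz A Ax sA; apply: yz => //; apply: xy. Qed.

Lemma mdist_chained e x y : mdist x y < e -> chained e x y.
Proof. by move=> xy A Ax sA; exact: sA Ax xy. Qed.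

Lemma chained_sym e x y : chained e x y -> chained e y x.
Proof.
move=> xy; apply: (xy [set z | chained e z x]); first exact: chained_refl.
move=> u v /= ux uv; apply: chained_trans ux.
by apply: mdist_chained; rewrite metric_sym.
Qed.

Lemma chained_le e e' x y : e <= e' -> chained e x y -> chained e' x y.
Proof.
move=> ee' xy A Ax sA; apply: xy => // u v Au uv.
by apply: sA Au _; apply: lt_le_trans ee'.
Qed.

Lemma open_mdistP A :
  open A <-> forall x, A x -> exists2 e, 0 < e & forall y, mdist x y < e -> A y.
Proof.
split=> [oA x Ax|Aloc].
  have /nbhs_ballP[e /= e0 eA] : nbhs x A by exact: open_nbhs_nbhs.
  by exists e => // y xy; apply: eA; rewrite ballEmdist.
rewrite openE => x /Aloc[e e0 eA]; apply/nbhs_ballP; exists e => // y.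
by rewrite ballEmdist; exact: eA.
Qed.

Lemma open_thickening e B : open [set z | exists2 b, B b & mdist b z < e].
Proof.
apply/open_mdistP => z /= [b Bb bz]; exists (e - mdist b z); first lra.
move=> y zy; exists b => //; have := metric_triangle b z y; lra.
Qed.

(** How compactness is used throughout: a property that holds near each point
    of [K] at all sufficiently small scales holds on all of [K] at a single
    scale. *)
Lemma compact_uniform_scale K (P : R -> X -> Prop) : compact K ->
  (forall x, K x -> exists2 e, 0 < e &
     forall y i, mdist x y < e -> 0 < i < e -> P i y) ->
  exists2 e, 0 < e & forall y, K y -> P e y.
Proof.
move=> /compact_near_coveringP cK Ploc.
have KP : \forall i \near 0^'+, K `<=` P i.
  apply: cK => x /Ploc[e e0 eP].
  exists (ball x e, [set i | 0 < i < e]) => /=.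
    split; first exact: nbhsx_ballx.
    near=> i; apply/andP; split; near: i.
      exact: nbhs_right_gt.
    exact: nbhs_right_lt.
  by move=> [y i] /=; rewrite ballEmdist => -[]; exact: eP.
near (0:R)^'+ => i; exists i; last by near: i.
by near: i; exact: nbhs_right_gt.
Unshelve. all: end_near. Qed.

Lemma closed_disjoint_gap A B : compact [set: X] -> closed A -> closed B ->
  A `&` B = set0 ->
  exists2 e, 0 < e & forall a b, A a -> B b -> e <= mdist a b.
Proof.
move=> cX cA cB AB0.
pose P e a := forall b, B b -> e <= mdist a b.
have [|a Aa|e e0 eP] := @compact_uniform_scale A P.
- exact: subclosed_compact cX _.
- have nBa : (~` B) a by move=> Ba; have : (A `&` B) a by []; rewrite AB0.
  have /open_mdistP/(_ a nBa)[e e0 eB] : open (~` B) by exact: closed_openC.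
  exists (e / 2); first lra.
  move=> y i ay ie b Bb; have [//|yb] := leP i (mdist y b).
  have : ~ B b by apply: eB; have := metric_triangle a y b; lra.
  by [].
- by exists e => // a b /eP; exact.
Qed.

(** The clopen sets of a compact space are exactly the sets stable under jumps
    at some scale, hence the name when [X] is compact. *)
Definition quasi_component x := [set y | forall e, 0 < e -> chained e x y].

(** Points at distance less than [e] are [e]-chained to the same points, so a
    failure at scale [e] persists on a ball of radius [e]. *)
Lemma closed_quasi_component x : closed (quasi_component x).
Proof.
rewrite -openC; apply/open_mdistP => y.
move=> /existsNP[e /not_implyP[e0 nxy]]; exists e => // z yz xz.
apply: nxy; apply: (@chained_trans _ z); first exact: xz.
by apply: mdist_chained; rewrite metric_sym.
Qed.

(** The sets of points [e]-chained to [x] decrease to the quasi-component as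
    [e] decreases, so one of them already misses the compact set [K]. *)
Lemma chained_avoid x K : compact K -> quasi_component x `&` K = set0 ->
  exists2 e, 0 < e & forall y, chained e x y -> ~ K y.
Proof.
move=> cK QK0; pose P e y := ~ chained e x y.
have [//|y Ky|e e0 eP] := @compact_uniform_scale K P; last first.
  by exists e => // y xy /eP.
have /existsNP[e /not_implyP[e0 nxy]] : ~ quasi_component x y.
  by move=> Qy; have : (quasi_component x `&` K) y by []; rewrite QK0.
exists e => // z i yz /andP[i0 ie] xz; apply: nxy.
apply: (@chained_trans _ z); first exact: chained_le (ltW ie) xz.
by apply: mdist_chained; rewrite metric_sym.
Qed.

(** With [e] the gap between [A] and [B], their [e / 3]-neighbourhoods cannot
    be joined by a jump shorter than [e / 3]. At a scale where chains from [x]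
    also stay inside the union of the two neighbourhoods, they never leave that
    of [A], which is disjoint from [B]. *)
Lemma quasi_component_unsplit x A B : compact [set: X] ->
  closed A -> closed B -> A `&` B = set0 -> quasi_component x = A `|` B ->
  A x -> B = set0.
Proof.
move=> cX cA cB AB0 QAB Ax.
have [e e0 gap] := closed_disjoint_gap cX cA cB AB0.
pose thick (S : set X) := [set z : X | exists2 s, S s & mdist s z < e / 3].
pose K := ~` (thick A `|` thick B).
have inA (S : set X) z : S z -> thick S z.
  by move=> Sz; exists z => //; rewrite mdistxx; lra.
have cK : compact K.
  apply: subclosed_compact cX _ => //; apply: open_closedC.
  by apply: openU; exact: open_thickening.
have QK0 : quasi_component x `&` K = set0.
  rewrite -subset0 QAB => z [[] /inA Sz]; apply; first by left.
  by right.
have [d d0 avoid] := chained_avoid cK QK0.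
pose i := Num.min d (e / 3).
have [id ie] : i <= d /\ i <= e / 3 by rewrite /i !ge_min !lexx orbT.
have i0 : 0 < i by rewrite lt_min d0; lra.
rewrite -subset0 => b Bb.
have xb : chained i x b by have : (A `|` B) b by [right]; rewrite -QAB; exact.
(* The set shown to be stable under jumps is the trace of the neighbourhood
   of [A] on the points chained to [x]. *)
suff [] : (chained i x `&` thick A) b.
  by move=> _ [a Aa ab]; have := gap _ _ Aa Bb; lra.
apply: xb; first by split; [exact: chained_refl | exact: inA].
move=> u v [xu [a Aa au]] uv.
have xv : chained i x v by apply: chained_trans xu _; exact: mdist_chained.
split => //.
have /avoid/contrapT[//|[b' Bb' bv]] := chained_le id xv.
have := gap _ _ Aa Bb'.
have := metric_triangle a u b'; have := metric_triangle u v b'.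
by rewrite (metric_sym v b'); lra.
Qed.

Lemma connected_quasi_component x :
  compact [set: X] -> connected (quasi_component x).
Proof.
move=> cX B [b Bb] [C oC BC] [D cD BD].
have cQ := closed_quasi_component (x := x).
have Qx : quasi_component x x by move=> e _; exact: chained_refl.
have cB : closed B by rewrite BD; exact: closedI.
pose B' := quasi_component x `&` ~` C.
have cB' : closed B' by apply: closedI => //; exact: open_closedC.
have QBB' : quasi_component x = B `|` B' by rewrite BC -setIUr setUv setIT.
have BB'0 : B `&` B' = set0 by rewrite BC setIACA setICr setI0.
have := Qx; rewrite {1}QBB' => -[Bx|B'x].
  by rewrite QBB' (quasi_component_unsplit cX cB cB' BB'0 QBB' Bx) setU0.
have B0 : B = set0.
  apply: (quasi_component_unsplit cX cB' cB _ _ B'x).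
    by rewrite setIC.
  by rewrite setUC.
by move: Bb; rewrite B0.
Qed.

(** The quasi-component of [x] is the singleton [x], so at some scale all points
    chained to [x] are within [eps / 2] of it. Points close to [x] are chained
    to the same points as [x], which makes the bound [eps] valid near [x]. *)
Lemma chained_mdist_small eps :
  compact [set: X] -> totally_disconnected [set: X] ->
  0 < eps -> exists2 e, 0 < e & forall x y, chained e x y -> mdist x y < eps.
Proof.
move=> cX tdX eps0; pose P e x := forall y, chained e x y -> mdist x y < eps.
have [//|x _|e e0 eP] := @compact_uniform_scale [set: X] P; last first.
  by exists e => // x y; exact: eP.
pose K := ~` [set z | exists2 s, [set x] s & mdist s z < eps / 2].
have cK : compact K.
  apply: subclosed_compact cX _ => //; apply: open_closedC.
  exact: open_thickening.
have Qx : quasi_component x `<=` [set x].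
  rewrite -(tdX x) // => y Qy.
  by exists (quasi_component x) => //; split => //;
    [move=> e _; exact: chained_refl | exact: connected_quasi_component].
have QK0 : quasi_component x `&` K = set0.
  rewrite -subset0 => z [/Qx -> ]; apply; exists x => //=.
  by rewrite mdistxx; lra.
have [e e0 avoid] := chained_avoid cK QK0.
have close z : chained e x z -> mdist x z < eps / 2.
  by move=> /avoid/contrapT[s /= ->].
exists e => // y i xy /andP[i0 ie] z yz.
have xye : chained e x y by exact: mdist_chained.
have xz : chained e x z.
  by apply: chained_trans xye _; exact: chained_le (ltW ie) yz.
have := metric_triangle y x z; have := close _ xye; have := close _ xz.
by rewrite (metric_sym y x); lra.
Qed.

End Chains.

(** The elements [h] such that [T h (x g)] and [x (h * g)] are [E]-related for
    all [g] form a subgroup. Quantifying over all [g] is what makes this set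
    stable under products and inverses; only [g = 1] is kept at the end. *)
Lemma pseudo_orbit_invariant_rel (R : realType) (G : groupType)
    (X : metricType R) (T : G -> X -> X) (A : set G) (delta : R)
    (E : X -> X -> Prop) (x : G -> X) :
  continuous_action T -> generates A ->
  (forall u, E u u) -> (forall u v, E u v -> E v u) ->
  (forall u v w, E u v -> E v w -> E u w) ->
  (forall g u v, E u v -> E (T g u) (T g v)) ->
  (forall u v, mdist u v < delta -> E u v) ->
  pseudo_orbit T A delta x -> forall g, E (T g (x 1%g)) (x g).
Proof.
move=> [T1 TM _] genA Er Es Et ET Ed xA.
pose H : {pred G} := [pred h | `[< forall g, E (T h (x g)) (x (h * g)%g) >]].
have HT : [set` H] = [set: G].
  apply: genA => [|a Aa]; last by apply/asboolP => g; apply: Ed; exact: xA.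
  split; first by apply/asboolP => g; rewrite T1 mul1g; exact: Er.
  move=> h k /asboolP Hh /asboolP Hk; apply/asboolP => g.
  have kV : E (T k^-1%g (x g)) (x (k^-1 * g)%g).
    apply: Es; have := ET k^-1%g _ _ (Hk (k^-1 * g)%g).
    by rewrite mulVKg -TM mulVg T1.
  rewrite TM -mulgA; apply: Et (Hh _); exact: ET.
move=> g; have : [set` H] g by rewrite HT.
by move=> /asboolP/(_ 1%g); rewrite mulg1.
Qed.

Theorem theorem4p1 (R : realType) (G : groupType) (X : metricType R)
    (T : G -> X -> X)
    (G_infinite : infinite_set [set: G]%classic)
    (G_fg : finitely_generated G)
    (X_cantor : is_cantor_space X)
    (T_action : continuous_action T)
    (T_equicontinuous : equicontinuous_action T) :
  POTP T.
Proof.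
have [A [finA genA]] := G_fg; exists A; split => // eps eps0.
have [_ cX tdX _] := X_cantor.
have [eta eta0 small] := chained_mdist_small cX tdX eps0.
have [delta delta0 equi] := T_equicontinuous _ eta0.
exists delta => // x x_po; exists (x 1%g) => g.
pose E u v := forall h, chained eta (T h u) (T h v).
have [T1 TM _] := T_action.
have Eg : E (T g (x 1%g)) (x g).
  apply: (pseudo_orbit_invariant_rel (E := E) T_action genA _ _ _ _ _ x_po).
  - by move=> u h; exact: chained_refl.
  - by move=> u v uv h; exact: chained_sym.
  - by move=> u v w uv vw h; exact: chained_trans (uv h) (vw h).
  - by move=> k u v uv h; rewrite -!TM.
  - by move=> u v uv h; apply: mdist_chained; exact: equi.
by have := Eg 1%g; rewrite !T1; exact: small.
Qed.
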